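(* Let $s\ge 1$ and $d\ge 1$ be integers. There exists an adaptive one-sided error tester for the property ''$s$-binary rank at most $d$'' of $n\times m$ $(0,1)$-matrices that makes $O\!\left(d\binom{d}{\le s}2^d/\epsilon\right)=\tilde O\!\left(\binom{d}{\le s}2^d/\epsilon\right)$ queries. The same query bound is achievable by an adaptive one-sided error tester for the property ''$s$-binary rank exactly $d$''.
   Context: For a $(0,1)$-matrix $M$ of size $n\times m$, $M[i,j]$ denotes its $(i,j)$ entry and $[n]=\{1,\dots,n\}$. The $s$-binary rank ${\rm br}_s(M)$ is the minimal integer $d\ge 0$ such that there exist $d$ sets (rectangles) $I_k\times J_k$ with $I_k\subseteq[n]$, $J_k\subseteq[m]$, $k\in[d]$, with $M[i,j]=1$ for all $(i,j)\in I_k\times J_k$ and all $k$, and such that every $(i,j)$ with $M[i,j]=1$ lies in at least one and at most $s$ of the rectangles. $\binom{d}{\le s}=\sum_{i=0}^{s}\binom{d}{i}$. A matrix $M$ is $\epsilon$-far from a property if more than an $\epsilon$-fraction of its $nm$ entries must be modified to obtain a matrix with the property. A tester receives $0<\epsilon<1$, $d,s,n,m$ and query access to the entries of $M$; if $M$ has the property it accepts with probability at least $2/3$, and if $M$ is $\epsilon$-far from the property it rejects with probability at least $2/3$. It is one-sided if it accepts matrices with the property with probability $1$. It is adaptive if queries may depend on previous answers. $\tilde O$ hides factors polylogarithmic in $\binom{d}{\le s}2^d$ and $1/\epsilon$. *)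

(* Defs.v *)
From HB Require Import structures.
From mathcomp Require Import all_boot all_order all_algebra.
From mathcomp Require Import reals.
From Stdlib Require Lists.List.
Set Implicit Arguments. Unset Strict Implicit. Unset Printing Implicit Defensive.
Import Order.TTheory GRing.Theory Num.Theory.
Local Open Scope ring_scope.

Definition bmat (n m : nat) := 'I_n -> 'I_m -> bool.

Definition binom_le (d s : nat) : nat := (\sum_(i < s.+1) 'C(d, i))%N.

Definition sbr_cover (s : nat) (n m : nat) (M : bmat n m) (d : nat) : Prop :=
  exists (I : 'I_d -> {set 'I_n}) (J : 'I_d -> {set 'I_m}),
    (forall k i j, i \in I k -> j \in J k -> M i j) /\
    (forall i j, M i j ->
       (1 <= #|[set k | (i \in I k) && (j \in J k)]| <= s)%N).

Definition sbr_le (s d : nat) (n m : nat) (M : bmat n m) : Prop :=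
  exists d', (d' <= d)%N /\ sbr_cover s M d'.

Definition sbr_eq (s d : nat) (n m : nat) (M : bmat n m) : Prop :=
  sbr_cover s M d /\ (forall d', (d' < d)%N -> ~ sbr_cover s M d').

Definition mdist (n m : nat) (M M' : bmat n m) : nat :=
  #|[set ij : 'I_n * 'I_m | M ij.1 ij.2 != M' ij.1 ij.2]|.

Definition far {R : realType} (eps : R) (n m : nat) (P : bmat n m -> Prop)
    (M : bmat n m) : Prop :=
  forall M', P M' -> eps * (n * m)%:R < (mdist M M')%:R.

(* Deterministic adaptive query algorithm = decision tree: each query to
   entry (i,j) may depend on all previous answers. *)
Inductive dtree (n m : nat) : Type :=
| Leaf of bool
| Query of 'I_n & 'I_m & (bool -> dtree n m).

Fixpoint run (n m : nat) (t : dtree n m) (M : bmat n m) : bool :=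
  match t with
  | Leaf b => b
  | Query i j k => run (k (M i j)) M
  end.

Fixpoint nqueries (n m : nat) (t : dtree n m) (M : bmat n m) : nat :=
  match t with
  | Leaf _ => 0%N
  | Query i j k => (nqueries (k (M i j)) M).+1
  end.

(* A randomized adaptive algorithm: a finite probability distribution over
   decision trees, given as a list of (probability, tree) pairs. *)
Definition rtester (R : realType) (n m : nat) := seq (R * dtree n m).

Definition is_distr {R : realType} (n m : nat) (D : rtester R n m) : Prop :=
  (forall p, Stdlib.Lists.List.In p D -> 0 <= p.1) /\ \sum_(p <- D) p.1 = 1.

Definition accept_prob {R : realType} (n m : nat) (D : rtester R n m)
    (M : bmat n m) : R :=
  \sum_(p <- D) p.1 * (run p.2 M)%:R.

Definition query_bound {R : realType} (n m : nat) (D : rtester R n m) (q : R) : Prop :=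
  forall p M, Stdlib.Lists.List.In p D -> (nqueries p.2 M)%:R <= q.

Definition tester_type (R : realType) :=
  R -> nat -> nat -> forall n m : nat, rtester R n m.

Definition one_sided_tester {R : realType} (T : tester_type R)
    (Prop_ : nat -> nat -> forall n m : nat, bmat n m -> Prop)
    (q : R -> nat -> nat -> R) : Prop :=
  forall (eps : R) (d s n m : nat), 0 < eps < 1 -> (1 <= s)%N -> (1 <= d)%N ->
    let D := T eps d s n m in
    [/\ is_distr D,
        query_bound D (q eps d s),
        (forall M, Prop_ s d n m M -> accept_prob D M = 1) &
        (forall M, far eps (Prop_ s d n m) M -> accept_prob D M <= 1/3)].

(* Main.v *)
Require Import Defs.
From HB Require Import structures.
From mathcomp Require Import all_boot all_order all_algebra.
From mathcomp Require Import reals boolp.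
From mathcomp Require Import lra zify.
Import Order.TTheory GRing.Theory Num.Theory.
Local Open Scope ring_scope.
Set Implicit Arguments. Unset Strict Implicit. Unset Printing Implicit Defensive.

(* The tester keeps row and column sets X, Y such that the rows, and the columns,
   of M[X,Y] are pairwise distinct.  Describing a row (column) by the set of
   rectangles that meet it, s-binary rank at most d gives two families of subsets
   of [d] with pairwise intersections of size at most s, whence
   |X||Y| <= B := binom_le d s * 2^d.  For a random entry (i,j) one tries to add i
   to X, j to Y, or both.  If M[X,Y] has rank at most d and all three attempts
   fail for most (i,j), then M is close to a blow-up of M[X,Y], so a far M makes
   some attempt succeed with probability at least eps.  An attempt costs
   c = |X'||Y'| - |X||Y| queries, exactly its gain in |X||Y| when it succeeds;
   making it with probability about 1/c, one round costs O(1) queries and gains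
   Omega(eps) in expectation.  As |X||Y| stays O(B), Markov's inequality shows
   that O(B/eps) rounds and queries suffice.

   For rank exactly d, write the rows of the d x d identity one at a time into a
   matrix of rank at most d: each raises the rank by at most 1, so rank exactly d
   is met after at most d^2 changes.  Hence far from rank exactly d implies
   eps/2-far from rank at most d, unless nm < 2d^2/eps and the whole matrix can
   be read. *)

(** * A bound on cross-intersecting families *)

Lemma big_subset_setU1 (T : finType) (x : T) (D : {set T})
    (F : {set T} -> nat) : x \notin D ->
  (\sum_(A : {set T} | A \subset x |: D) F A =
   \sum_(A : {set T} | A \subset D) F A +
   \sum_(A : {set T} | A \subset D) F (x |: A))%N.
Proof.
move=> xD; rewrite (bigID (fun A : {set T} => x \in A)) /= addnC; congr addn.
  by apply: eq_bigl => A; rewrite -subsetD1 setU1K.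
rewrite (reindex_onto (fun A => x |: A) (fun A => A :\ x)) /=; last first.
  by move=> A /andP[_ xA]; rewrite setD1K.
apply: eq_bigl => A; rewrite setU11 andbT.
apply/andP/idP => [[sA /eqP <-]|sA].
  by rewrite -(setU1K xD) setSD.
by rewrite setUS // setU1K // (contra _ xD) //; apply: (subsetP sA).
Qed.

(** Harris's inequality: decreasing functions on the subsets of a finite set are positively
    correlated. Induction on the ground set, splitting the subsets by membership of one element
    [x]. *)
Lemma harris (T : finType) (f g : {set T} -> nat) :
  (forall A B : {set T}, A \subset B -> f B <= f A)%N ->
  (forall A B : {set T}, A \subset B -> g B <= g A)%N ->
  ((\sum_A f A) * (\sum_A g A) <= 2 ^ #|T| * \sum_A f A * g A)%N.
Proof.
suff H k (D : {set T}) : #|D| = k -> forall f g : {set T} -> nat,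
  (forall A B : {set T}, A \subset B -> f B <= f A)%N ->
  (forall A B : {set T}, A \subset B -> g B <= g A)%N ->
  ((\sum_(A : {set T} | A \subset D) f A) * (\sum_(A : {set T} | A \subset D) g A)
     <= 2 ^ k * \sum_(A : {set T} | A \subset D) f A * g A)%N.
  move=> fD gD; have := H _ _ (cardsT T) _ _ fD gD.
  have e F : \sum_(A : {set T} | A \subset setT) F A = \sum_A F A.
    by apply: eq_bigl => A; rewrite subsetT.
  by rewrite !e.
elim: k D => [D /cards0_eq ->|k IH D cD] {}f {}g fD gD.
  rewrite mul1n; do !rewrite (eq_bigl (pred1 set0)) ?big_pred1_eq //;
    by move=> A; rewrite /= subset0.
have [x xD] : exists x, x \in D by apply/card_gt0P; rewrite cD.
rewrite -(setD1K xD); set D' := D :\ x.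
have xD' : x \notin D' by rewrite !inE eqxx.
have cD' : #|D'| = k by move: (cardsD1 x D); rewrite xD cD => -[].
rewrite !big_subset_setU1 // expnS.
have I0 := IH _ cD' _ _ fD gD.
have I1 := IH _ cD' (fun A => f (x |: A)) (fun A => g (x |: A))
  (fun A B s => fD _ _ (setUS _ s)) (fun A B s => gD _ _ (setUS _ s)).
have lef : (\sum_(A : {set T} | A \subset D') f (x |: A) <= \sum_(A : {set T} | A \subset D') f A)%N.
  by apply: leq_sum => A _; apply/fD/subsetUr.
have leg : (\sum_(A : {set T} | A \subset D') g (x |: A) <= \sum_(A : {set T} | A \subset D') g A)%N.
  by apply: leq_sum => A _; apply/gD/subsetUr.
(* With [a], [b] the sums without [x] and [c], [e] those with [x], [(a - c) * (b - e) >= 0] yields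
   [a * e + c * b <= a * b + c * e]. *)
have chebyshev a b c e p q : (c <= a -> e <= b -> a * b <= p -> c * e <= q ->
    (a + c) * (b + e) <= 2 * (p + q))%N.
  by move=> /subnK <- /subnK <-; nia.
by rewrite -mulnA [X in (_ <= 2 * X)%N]mulnDr; apply: chebyshev.
Qed.

(* Shrinking the sets preserves the hypothesis, so both families may be replaced
   by their down-closures; these are positively correlated and a common member
   C of both has size #|C :&: C| <= s. *)
Lemma cross_intersection_bound (T : finType) (s : nat) (FA FB : {set {set T}}) :
  (forall A B, A \in FA -> B \in FB -> #|A :&: B| <= s)%N ->
  (#|FA| * #|FB| <= binom_le #|T| s * 2 ^ #|T|)%N.
Proof.
move=> sAB.
pose dn (F : {set {set T}}) (A : {set T}) := [exists B in F, A \subset B].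
have dnD F (A B : {set T}) : A \subset B -> (dn F B <= dn F A)%N.
  move=> AB; case: (boolP (dn F B)) => // /exists_inP[C CF BC].
  rewrite lt0b; apply/exists_inP; exists C => //; exact: subset_trans BC.
have leF (F : {set {set T}}) : (#|F| <= \sum_A dn F A)%N.
  rewrite -sum1_card big_mkcond leq_sum // => A _; case: ifP => // AF.
  by rewrite lt0b; apply/exists_inP; exists A.
apply: leq_trans (leq_mul (leF FA) (leF FB)) _.
apply: leq_trans (harris (dnD FA) (dnD FB)) _.
rewrite mulnC leq_mul2r; apply/orP; right.
have -> : binom_le #|T| s = (\sum_(A : {set T}) (#|A| <= s))%N.
  rewrite /binom_le; under eq_bigr => i _ do rewrite -card_draws -sum1_card.
  under eq_bigr => i _ do rewrite big_mkcond /=.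
  rewrite exchange_big /=; apply: eq_bigr => A _.
  under eq_bigr => i _ do rewrite inE.
  case: leqP => [le|gt].
    rewrite (bigD1 (Ordinal (le : #|A| < s.+1)%N)) //= eqxx big1 // => i.
    by rewrite -val_eqE /= eq_sym => /negbTE ->.
  by rewrite big1 // => i _; case: eqP => // e; move: (ltn_ord i); rewrite -e ltnS leqNgt gt.
apply: leq_sum => A _; case: (boolP (dn FA A)) => // /exists_inP[B BA AB].
case: (boolP (dn FB A)) => // /exists_inP[C CB AC].
by rewrite lt0b (leq_trans _ (sAB _ _ BA CB)) // subset_leq_card // subsetI AB.
Qed.

(** * Distinct rows and columns *)

Section Submatrices.
Variables (n m : nat).
Implicit Types (M A : bmat n m) (X : {set 'I_n}) (Y : {set 'I_m}).

(* s-binary rank at most d for the submatrix M[X,Y], written with ambient indices. *)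
Definition subcover (s d : nat) M X Y : Prop :=
  exists (I : 'I_d -> {set 'I_n}) (J : 'I_d -> {set 'I_m}),
    (forall k i j, i \in X -> j \in Y -> i \in I k -> j \in J k -> M i j) /\
    (forall i j, i \in X -> j \in Y -> M i j ->
       (1 <= #|[set k | (i \in I k) && (j \in J k)]| <= s)%N).

Definition agree A M X Y := forall i j, i \in X -> j \in Y -> A i j = M i j.

Lemma agree_subcover s d A M X Y :
  agree A M X Y -> subcover s d A X Y -> subcover s d M X Y.
Proof.
move=> eAM [I [J [IJ1 IJs]]]; exists I, J; split=> [k i j iX jY|i j iX jY].
  by rewrite -eAM //; apply: IJ1.
by rewrite -eAM //; apply: IJs.
Qed.

Lemma sbr_cover_sub s d M X Y : sbr_cover s M d -> subcover s d M X Y.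
Proof. by move=> [I [J [IJ1 IJs]]]; exists I, J; split=> *; eauto. Qed.

Lemma sbr_cover_widen s M d d' : (d <= d')%N -> sbr_cover s M d -> sbr_cover s M d'.
Proof.
move=> dd' [I [J [IJ1 IJs]]].
pose ext T (F : 'I_d -> {set T}) (k : 'I_d') := oapp F set0 (insub (val k)).
exists (ext _ I), (ext _ J); rewrite /ext; split=> [k i j|i j Mij].
  by case: insubP => [k' _ _|_] /=; [apply: IJ1 | rewrite inE].
rewrite (_ : #|_| = #|[set k | (i \in I k) && (j \in J k)]|); first exact: IJs.
have wI : injective (widen_ord dd') by move=> k k' [e]; apply: val_inj.
rewrite -(card_imset _ wI); apply: eq_card => k.
rewrite inE; apply/idP/imsetP => [|[k' + ->]].
  case: insubP => [k' _ e|_] /=; last by rewrite inE.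
  by move=> h; exists k'; rewrite ?inE //; apply: val_inj.
by rewrite inE /=; case: insubP => [k'' _ /val_inj -> //|]; rewrite /= ltn_ord.
Qed.

Lemma sbr_leE s d M : sbr_le s d M <-> sbr_cover s M d.
Proof. by split=> [[d' [dd']]|]; [apply: sbr_cover_widen | exists d]. Qed.

End Submatrices.

Section Distinct.
Variables (I J : finType).
Implicit Types (M A : I -> J -> bool) (X : {set I}) (Y : {set J}).

(** Arbitrary index types let the same notion, applied to the transpose, express distinct
    columns. *)
Definition distinct_rows M X Y : Prop :=
  forall i i', i \in X -> i' \in X -> (forall j, j \in Y -> M i j = M i' j) -> i = i'.

Lemma distinct_rowsW M X Y Y' :
  Y \subset Y' -> distinct_rows M X Y -> distinct_rows M X Y'.
Proof.
move=> /subsetP sY dX i i' iX i'X e; apply: dX => // j /sY; exact: e.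
Qed.

Lemma distinct_rowsU1 M X Y i : distinct_rows M X Y ->
  (forall x, x \in X -> ~ forall j, j \in Y -> M i j = M x j) ->
  distinct_rows M (i |: X) Y.
Proof.
move=> dX new x x'; rewrite !inE => /orP[/eqP->|xX] /orP[/eqP->|x'X] // e.
- by case: (new x').
- by case: (new x) => // j jY; rewrite e.
- exact: dX.
Qed.

End Distinct.

Section Reduced.
Variables (n m : nat).
Implicit Types (M A : bmat n m) (X : {set 'I_n}) (Y : {set 'I_m}).

Definition reduced M X Y : Prop :=
  distinct_rows M X Y /\ distinct_rows (fun j i => M i j) Y X.

Lemma agree_reduced A M X Y : agree A M X Y -> reduced A X Y <-> reduced M X Y.
Proof.
move=> e; split=> -[dr dc]; split=> i i' iX i'X e'; (apply: dr || apply: dc) => // j jY;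
  by [rewrite !e //; apply: e' | rewrite -!e //; apply: e'].
Qed.

Lemma reduced_set11 M i j : reduced M [set i] [set j].
Proof. by split=> x x' /set1P -> /set1P ->. Qed.

(** An entry is 1 exactly when the set of rectangles meeting its row intersects that of its column.
    Distinct rows (columns) thus have distinct sets, and a row set and a column set share at most
    [s] rectangles. *)
Lemma reduced_card s d M X Y : subcover s d M X Y -> reduced M X Y ->
  (#|X| * #|Y| <= binom_le d s * 2 ^ d)%N.
Proof.
move=> [I [J [IJ1 IJs]]] [dr dc].
pose rI i := [set k | i \in I k]; pose rJ j := [set k | j \in J k].
have ME i j : i \in X -> j \in Y -> M i j = (rI i :&: rJ j != set0).
  move=> iX jY; apply/idP/set0Pn => [/(IJs _ _ iX jY)/andP[/card_gt0P[k]]|[k]].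
    by rewrite inE => h _; exists k; rewrite !inE.
  by rewrite !inE => /andP[]; apply: IJ1.
have injI : {in X &, injective rI}.
  by move=> i i' iX i'X e; apply: dr => // j jY; rewrite !ME // e.
have injJ : {in Y &, injective rJ}.
  by move=> j j' jY j'Y e; apply: dc => // i iX; rewrite !ME // e.
rewrite -(card_in_imset injI) -(card_in_imset injJ).
have := @cross_intersection_bound 'I_d s (rI @: X) (rJ @: Y).
rewrite card_ord; apply=> _ _ /imsetP[i iX ->] /imsetP[j jY ->].
case: (boolP (M i j)) => [/(IJs _ _ iX jY)/andP[_]|].
  by congr (_ <= s)%N; apply: eq_card => k; rewrite !inE.
by rewrite ME // negbK => /eqP ->; rewrite cards0.
Qed.

End Reduced.

(** * Successful attempts in far matrices *)

Section Progress.
Variables (R : realType) (n m : nat).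
Implicit Types (M : bmat n m) (X : {set 'I_n}) (Y : {set 'I_m}).

Definition grow (T : finType) (b : bool) (x : T) (X : {set T}) := if b then x |: X else X.

(** Strict growth discards attempts that add only indices already present. *)
Definition fresh M X Y (ab : bool * bool) (i : 'I_n) (j : 'I_m) : bool :=
  let X' := grow ab.1 i X in let Y' := grow ab.2 j Y in
  `[< reduced M X' Y' >] && (#|X| * #|Y| < #|X'| * #|Y'|)%N.

Lemma subcover_blowup s d M X Y (r : 'I_n -> 'I_n) (c : 'I_m -> 'I_m) :
  (forall i, r i \in X) -> (forall j, c j \in Y) ->
  subcover s d M X Y -> sbr_cover s (fun i j => M (r i) (c j)) d.
Proof.
move=> rX cY [I [J [IJ1 IJs]]].
exists (fun k => r @^-1: I k), (fun k => c @^-1: J k); split=> [k i j|i j Mij].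
  by rewrite !inE; apply: IJ1.
rewrite (_ : [set k | _] = [set k | (r i \in I k) && (c j \in J k)]).
  exact: IJs (rX i) (cY j) Mij.
by apply/setP => k; rewrite !inE.
Qed.

(** If row [i] agrees on [Y] with no row of [X], add [i] alone; likewise for [j]. Otherwise [r i]
    and [c j] are their unique twins, and the mismatch separates [i] from its twin in column [j] and
    [j] from its twin in row [i], so both can be added. *)
Lemma fresh_of_mismatch M X Y x0 y0 (r : 'I_n -> 'I_n) (c : 'I_m -> 'I_m) i j :
  reduced M X Y -> x0 \in X -> y0 \in Y -> r i \in X -> c j \in Y ->
  ((exists2 x, x \in X & forall y, y \in Y -> M i y = M x y) ->
     forall y, y \in Y -> M i y = M (r i) y) ->
  ((exists2 y, y \in Y & forall x, x \in X -> M x j = M x y) ->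
     forall x, x \in X -> M x j = M x (c j)) ->
  M i j != M (r i) (c j) -> exists ab, fresh M X Y ab i j.
Proof.
move=> [dr dc] x0X y0Y rX cY ri cj Mij.
have cardX : (0 < #|X|)%N by apply/card_gt0P; exists x0.
have cardY : (0 < #|Y|)%N by apply/card_gt0P; exists y0.
have [mi|nmi] := pselect (exists2 x, x \in X & forall y, y \in Y -> M i y = M x y); last first.
  exists (true, false); apply/andP; split => /=; last first.
    rewrite ltn_mul2r cardY cardsU1 -[ltnLHS]add0n ltn_add2r; case iX: (i \in X) => //.
    by case: nmi; exists i.
  apply/asboolP; split; last exact: distinct_rowsW (subsetUr _ _) dc.
  by apply: distinct_rowsU1 => // x xX e; apply: nmi; exists x.
have [mj|nmj] := pselect (exists2 y, y \in Y & forall x, x \in X -> M x j = M x y); last first.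
  exists (false, true); apply/andP; split => /=; last first.
    rewrite ltn_mul2l cardX cardsU1 -[ltnLHS]add0n ltn_add2r; case jY: (j \in Y) => //.
    by case: nmj; exists j.
  apply/asboolP; split; first exact: distinct_rowsW (subsetUr _ _) dr.
  by apply: distinct_rowsU1 => // y yY e; apply: nmj; exists y.
have {}ri := ri mi; have {}cj := cj mj.
exists (true, true); apply/andP; split => /=; last first.
  (* For [i] in [X] one would have [M i j = M i (c j) = M (r i) (c j)]. *)
  have iX : i \notin X by apply: contraNN Mij => iX; rewrite cj // ri.
  apply: (@leq_trans (#|i |: X| * #|Y|)); last by rewrite leq_mul2l subset_leq_card ?subsetUr ?orbT.
  by rewrite ltn_mul2r cardY cardsU1 iX leqnn.
apply/asboolP; split.
  apply: distinct_rowsU1; first exact: distinct_rowsW (subsetUr _ _) dr.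
  move=> x xX e; have ex : r i = x.
    by apply: dr => // y yY; rewrite -ri // e // inE yY orbT.
  by move/eqP: Mij; apply; rewrite e ?setU11 // -ex cj.
apply: distinct_rowsU1; first exact: distinct_rowsW (subsetUr _ _) dc.
move=> y yY e; have ey : c j = y.
  by apply: dc => // x xX; rewrite -cj // e // inE xX orbT.
by move/eqP: Mij; apply; rewrite e ?setU11 // -ey ri.
Qed.

Lemma far_fresh (eps : R) s d M X Y x0 y0 :
  reduced M X Y -> subcover s d M X Y -> x0 \in X -> y0 \in Y ->
  far eps (@sbr_le s d n m) M ->
  eps * (n * m)%:R <= \sum_ij \sum_ab (fresh M X Y ab ij.1 ij.2)%:R.
Proof.
move=> red cov x0X y0Y farM.
(* [x0] and [y0] are mere defaults for rows and columns without a twin; the blow-up along [r] and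
   [c] has rank at most [d]. *)
pose r i := odflt x0 [pick x | (x \in X) && [forall y in Y, M i y == M x y]].
pose c j := odflt y0 [pick y | (y \in Y) && [forall x in X, M x j == M x y]].
have rX i : r i \in X by rewrite /r; case: pickP => // x /andP[].
have cY j : c j \in Y by rewrite /c; case: pickP => // y /andP[].
have rE i : (exists2 x, x \in X & forall y, y \in Y -> M i y = M x y) ->
    forall y, y \in Y -> M i y = M (r i) y.
  move=> [x xX ex] y yY; rewrite /r; case: pickP => [x' /andP[_ /forall_inP h]|/(_ x)].
    by apply/eqP/h.
  by rewrite xX => /forall_inP[] z zY; apply/eqP/ex.
have cE j : (exists2 y, y \in Y & forall x, x \in X -> M x j = M x y) ->
    forall x, x \in X -> M x j = M x (c j).
  move=> [y yY ey] x xX; rewrite /c; case: pickP => [y' /andP[_ /forall_inP h]|/(_ y)].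
    by apply/eqP/h.
  by rewrite yY => /forall_inP[] z zX; apply/eqP/ey.
have /farM /ltW /le_trans : sbr_le s d (fun i j => M (r i) (c j)).
  exact/sbr_leE/(subcover_blowup rX cY cov).
apply; rewrite /mdist -sum1_card natr_sum big_mkcond ler_sum // => -[i j] _ /=.
rewrite inE /=; case: ifPn => [Mij|_]; last by rewrite sumr_ge0.
have [ab f] := fresh_of_mismatch red x0X y0Y (rX i) (cY j) (rE i) (cE j) Mij.
by rewrite (bigD1 ab) //= f lerDl sumr_ge0.
Qed.

End Progress.

(** * The search procedure *)

Section DecisionTrees.
Variables (n m : nat).
Implicit Types (M A : bmat n m) (t : dtree n m).

Fixpoint ask (l : seq ('I_n * 'I_m)) A (k : bmat n m -> dtree n m) : dtree n m :=
  if l is p :: l' then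
    Query p.1 p.2 (fun b => ask l' (fun i j => if (i, j) == p then b else A i j) k)
  else k A.

Lemma askP l A k M : exists A',
  [/\ (forall i j, A' i j = if (i, j) \in l then M i j else A i j),
      run (ask l A k) M = run (k A') M &
      nqueries (ask l A k) M = (size l + nqueries (k A') M)%N].
Proof.
elim: l A => [|p l IH] A /=; first by exists A.
have [A' [eA' rA' qA']] := IH (fun i j => if (i, j) == p then M p.1 p.2 else A i j).
exists A'; split; [move=> i j | exact: rA' | by rewrite qA' addSn].
by rewrite eA' inE; case: eqP => [<-|_] /=; case: ifP.
Qed.

(** Running out of queries accepts, which keeps the error one-sided. *)
Fixpoint trunc q t : dtree n m :=
  match t with
  | Leaf b => Leaf n m b
  | Query i j k => if q is q'.+1 then Query i j (fun b => trunc q' (k b)) else Leaf n m true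
  end.

Lemma nqueries_trunc q t M : (nqueries (trunc q t) M <= q)%N.
Proof.
elim: t q => [b|i j k IH] [|q] //=; exact: IH.
Qed.

Lemma run_trunc q t M : run t M -> run (trunc q t) M.
Proof. elim: t q => [b|i j k IH] [|q] //=; exact: IH. Qed.

Lemma run_trunc_le q t M : run (trunc q t) M -> run t M || (q < nqueries t M)%N.
Proof.
elim: t q => [b|i j k IH] [|q] /=.
- by move=> ->.
- by move=> ->.
- by rewrite orbT.
- by move=> /IH; rewrite ltnS.
Qed.

End DecisionTrees.

Section Algorithm.
Variables (n m : nat).
Implicit Types (M A : bmat n m) (X : {set 'I_n}) (Y : {set 'I_m}).

(* Which of i and j to add, the entry (i, j), and the threshold of the attempt. *)
Definition sample : finType := ((bool * bool) * ('I_n * 'I_m) * 'I_(n * m))%type.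

Implicit Types (w : sample).

Definition growX w X := grow w.1.1.1 w.1.2.1 X.
Definition growY w Y := grow w.1.1.2 w.1.2.2 Y.

Definition increment X Y w : nat := (#|growX w X| * #|growY w Y| - #|X| * #|Y|)%N.

(* A uniform w.2 < n * m makes the attempt with probability about 1 / increment,
   so that the expected price is O(1) whatever the increment. *)
Definition price X Y w : nat :=
  if (w.2 * increment X Y w < n * m)%N then increment X Y w else 0%N.

Definition gain M X Y w : nat :=
  if `[< reduced M (growX w X) (growY w Y) >] then price X Y w else 0%N.

(* A stores the answers obtained so far; only its values on X x Y are meaningful. *)
Fixpoint search (s d : nat) X Y A (tape : seq sample) : dtree n m :=
  if `[< subcover s d A X Y >] then
    if tape is w :: tape' then
      if (w.2 * increment X Y w < n * m)%N then
        ask (enum (setX (growX w X) (growY w Y) :\: setX X Y)) A (fun A' =>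
          if `[< reduced A' (growX w X) (growY w Y) >]
          then search s d (growX w X) (growY w Y) A' tape'
          else search s d X Y A' tape')
      else search s d X Y A tape'
    else Leaf n m true
  else Leaf n m false.

Lemma sub_growX w X : X \subset growX w X.
Proof. by rewrite /growX /grow; case: ifP => // _; apply: subsetUr. Qed.

Lemma sub_growY w Y : Y \subset growY w Y.
Proof. by rewrite /growY /grow; case: ifP => // _; apply: subsetUr. Qed.

Lemma agree_sym A M X Y : agree A M X Y -> agree M A X Y.
Proof. by move=> e i j iX jY; rewrite e. Qed.

Lemma card_grow (T : finType) (b : bool) (x : T) (X : {set T}) :
  (#|grow b x X| <= #|X|.+1)%N.
Proof.
by rewrite /grow; case: b => //; rewrite cardsU1 -add1n leq_add2r leq_b1.
Qed.

(** One round as a step on states: the new state is the same for every rest of the tape. Each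
    nonempty side grows by at most one, so it at most doubles; hence the factor 4. *)
Lemma search_cons s d X Y A M w : agree A M X Y -> reduced M X Y ->
    subcover s d M X Y -> (0 < #|X|)%N -> (0 < #|Y|)%N ->
  exists X1 Y1 A1,
    [/\ agree A1 M X1 Y1, reduced M X1 Y1,
        (0 < #|X1|)%N /\ (0 < #|Y1|)%N,
        (#|X1| * #|Y1| = #|X| * #|Y| + gain M X Y w)%N &
        (#|X1| * #|Y1| <= 4 * (#|X| * #|Y|))%N] /\
        forall tape,
          run (search s d X Y A (w :: tape)) M = run (search s d X1 Y1 A1 tape) M /\
          nqueries (search s d X Y A (w :: tape)) M =
            (price X Y w + nqueries (search s d X1 Y1 A1 tape) M)%N.
Proof.
move=> eA red cov X0 Y0.
have covA : subcover s d A X Y by apply: agree_subcover cov; apply: agree_sym.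
have le4 : (#|X| * #|Y| <= 4 * (#|X| * #|Y|))%N by rewrite leq_pmull.
rewrite /gain /price /=; case: (ltnP (w.2 * increment X Y w) (n * m)) => _; last first.
  exists X, Y, A; split; last by move=> tape; rewrite (asboolT covA).
  by split=> //; case: ifP; rewrite addn0.
set X' := growX w X; set Y' := growY w Y; set l := enum _.
have sX : X \subset X' := sub_growX w X; have sY : Y \subset Y' := sub_growY w Y.
have sXY : setX X Y \subset setX X' Y' by apply: setXS.
have sl : size l = increment X Y w.
  by rewrite -cardE cardsD (setIidPr sXY) !cardsX.
have leXY : (#|X| * #|Y| <= #|X'| * #|Y'|)%N by rewrite leq_mul ?subset_leq_card.
pose A' i j := if (i, j) \in l then M i j else A i j.
have eA' : agree A' M X' Y'.
  move=> i j iX jY; rewrite /A' mem_enum in_setD !in_setX iX jY !andbT.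
  by case: andP => [[iX' jY']|_] //=; apply: eA.
have step k : run (ask l A k) M = run (k A') M /\
    nqueries (ask l A k) M = (increment X Y w + nqueries (k A') M)%N.
  have [A2 [eA2 -> ->]] := askP l A k M.
  have -> : A2 = A' by apply/funext => i; apply/funext => j; rewrite eA2.
  by rewrite sl.
have [r'|nr'] := pselect (reduced M X' Y'); last first.
  exists X, Y, A'; split; last first.
    move=> tape; rewrite (asboolT covA) !(step _).1 !(step _).2 asboolF //.
    by move=> /(agree_reduced eA').
  split=> //; last by rewrite asboolF // addn0.
  by move=> i j /(subsetP sX) iX /(subsetP sY); apply: eA'.
exists X', Y', A'; split; last first.
  move=> tape; rewrite (asboolT covA) !(step _).1 !(step _).2 asboolT //.
  exact/(agree_reduced eA').
split=> //.
- by split; [apply: leq_trans X0 _ | apply: leq_trans Y0 _]; apply: subset_leq_card.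
- by rewrite asboolT // /increment subnKC.
- apply: (@leq_trans ((#|X| + #|X|) * (#|Y| + #|Y|))); last by rewrite !addnn -!mul2n mulnACA.
  apply: leq_mul; [apply: leq_trans (card_grow _ _ _) _ | apply: leq_trans (card_grow _ _ _) _];
    by rewrite -[X in (X <= _)%N]add1n leq_add2r.
Qed.

End Algorithm.

(** * Averages over uniform tapes *)

Section Expectation.
Variables (R : realType) (T : finType).

Fixpoint tapes (k : nat) : seq (seq T) :=
  if k is k'.+1 then [seq w :: t | w <- enum T, t <- tapes k'] else [:: [::]].

Definition expect k (f : seq T -> R) : R := (#|T|%:R^-1) ^+ k * \sum_(t <- tapes k) f t.

Lemma expectS k f :
  expect k.+1 f = #|T|%:R^-1 * \sum_w expect k (fun t => f (w :: t)).
Proof.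
rewrite /expect /= big_allpairs_dep big_enum /= exprS -mulrA; congr (_ * _).
by rewrite mulr_sumr.
Qed.

Lemma expect_le k f g : (forall t, f t <= g t) -> expect k f <= expect k g.
Proof.
move=> fg; rewrite ler_wpM2l ?exprn_ge0 ?invr_ge0 //; exact: ler_sum.
Qed.

Lemma expect_cst k c : (0 < #|T|)%N -> expect k (fun=> c) = c.
Proof.
move=> T0; elim: k => [|k IH]; first by rewrite /expect big_seq1 mul1r.
rewrite expectS; under eq_bigr do rewrite IH.
by rewrite sumr_const -[X in _ * X]mulr_natl mulrA mulVf ?mul1r // pnatr_eq0 -lt0n.
Qed.

Lemma expectD k f g : expect k (fun t => f t + g t) = expect k f + expect k g.
Proof. by rewrite /expect big_split mulrDr. Qed.

Lemma expectZ k c f : expect k (fun t => c * f t) = c * expect k f.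
Proof. by rewrite /expect -mulr_sumr mulrCA. Qed.

Lemma eq_expect k f g : (forall t, f t = g t) -> expect k f = expect k g.
Proof. by move=> fg; rewrite /expect (eq_bigr g). Qed.

End Expectation.

(** * Expected gain and cost *)

Section Analysis.
Variables (n m : nat).
Implicit Types (M A : bmat n m) (X : {set 'I_n}) (Y : {set 'I_m}).

(** The amount [c] is paid only while [u * c < N], so the total overshoots [N] by at most [c]. *)
Lemma sum_cap_le c N : (\sum_(u < N) (if u * c < N then c else 0) <= N + c)%N.
Proof.
suff H k : (\sum_(u < k) (if u * c < N then c else 0) <= minn (N + c) (k * c))%N.
  by apply: leq_trans (H N) (geq_minl _ _).
elim: k => [|k IH]; first by rewrite big_ord0.
rewrite big_ord_recr /= mulSn; move: (\sum_(_ < k) _)%N (k * c)%N IH => S p.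
by case: ifP; lia.
Qed.

Lemma sum_cap_ge c N : (0 < c)%N -> (N <= \sum_(u < N) (if u * c < N then c else 0))%N.
Proof.
move=> c0; suff H k : (minn N (k * c) <= \sum_(u < k) (if u * c < N then c else 0))%N.
  by apply: leq_trans (H N); rewrite leq_min leqnn leq_pmulr.
elim: k => [|k IH]; first by rewrite mul0n minn0.
rewrite big_ord_recr /= mulSn; move: (\sum_(_ < k) _)%N (k * c)%N IH => S p.
by case: ifP; lia.
Qed.

Lemma sum_sample (F : sample n m -> nat) :
  (\sum_w F w = \sum_ij \sum_ab \sum_u F (ab, ij, u))%N.
Proof.
rewrite exchange_big pair_bigA pair_bigA /=.
by apply: eq_bigr => -[[]].
Qed.

Lemma card_sample : #|sample n m| = (4 * (n * m) * (n * m))%N.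
Proof. by rewrite !card_prod card_bool !card_ord. Qed.

Lemma leq_card_setX X Y : (#|X| * #|Y| <= n * m)%N.
Proof.
by rewrite leq_mul // -[X in (_ <= X)%N]card_ord max_card.
Qed.

(** An increment is at most [n * m], so averaging over the threshold alone already gives an expected
    price of at most 2. *)
Lemma sum_price X Y : (\sum_w price X Y w <= 2 * #|sample n m|)%N.
Proof.
rewrite sum_sample -sum1_card sum_sample big_distrr /=.
apply: leq_sum => ij _; rewrite big_distrr; apply: leq_sum => ab _ /=.
rewrite sum_nat_const card_ord muln1 mul2n -addnn.
rewrite /price /increment /growX /growY /=; apply: leq_trans (sum_cap_le _ _) _.
by rewrite leq_add2l (leq_trans (leq_subr _ _)) ?leq_card_setX.
Qed.

(** Averaged over the threshold, a successful attempt gains at least 1. *)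
Lemma sum_gain M X Y :
  ((\sum_ij \sum_ab fresh M X Y ab ij.1 ij.2) * (n * m) <= \sum_w gain M X Y w)%N.
Proof.
rewrite sum_sample big_distrl /=; apply: leq_sum => ij _.
rewrite big_distrl /=; apply: leq_sum => ab _.
rewrite /fresh /gain /price /increment /growX /growY /=.
case: asboolP => _ //=; case: ltnP => // lt; rewrite mul1n.
by apply: sum_cap_ge; rewrite subn_gt0.
Qed.

End Analysis.

(** * Acceptance probability and expected number of queries *)

Section Acceptance.
Variables (R : realType) (n m s d : nat).
Hypothesis nm_gt0 : (0 < n * m)%N.
Implicit Types (M A : bmat n m) (X : {set 'I_n}) (Y : {set 'I_m}).

Let B := (binom_le d s * 2 ^ d)%N.

Lemma sample_gt0 : (0 < #|sample n m|)%N.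
Proof. by move: nm_gt0; rewrite card_sample !muln_gt0 => /andP[-> ->]. Qed.

Lemma search_uncovered X Y A tape :
  ~ subcover s d A X Y -> search s d X Y A tape = Leaf n m false.
Proof. by move=> nc; case: tape => [|w tape] /=; rewrite asboolF. Qed.

Lemma run_search_of_cover M X Y A tape :
  agree A M X Y -> reduced M X Y -> (0 < #|X|)%N -> (0 < #|Y|)%N ->
  sbr_cover s M d -> run (search s d X Y A tape) M.
Proof.
move=> + + + + cM; elim: tape X Y A => [|w tape IH] X Y A eA red X0 Y0.
  by rewrite /= asboolT //; apply: agree_subcover (agree_sym eA) (sbr_cover_sub _ _ cM).
have [X1 [Y1 [A1 [[eA1 red1 [X10 Y10] _ _]]]]] :=
  search_cons w eA red (sbr_cover_sub X Y cM) X0 Y0.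
by move=> /(_ tape)[-> _]; apply: IH.
Qed.

Lemma expect_queries M k X Y A :
  agree A M X Y -> reduced M X Y -> (0 < #|X|)%N -> (0 < #|Y|)%N ->
  expect k (fun t => (nqueries (search s d X Y A t) M)%:R) <= 2 * k%:R :> R.
Proof.
elim: k X Y A => [|k IH] X Y A eA red X0 Y0.
  by rewrite /expect big_seq1 /=; case: ifP; rewrite mulr0 ?mulr0.
have [cov|ncov] := pselect (subcover s d A X Y); last first.
  under eq_expect do rewrite search_uncovered //.
  by rewrite expect_cst ?sample_gt0 // mulr_ge0.
have T0 : 0 < #|sample n m|%:R :> R by rewrite ltr0n sample_gt0.
rewrite expectS mulrC ler_pdivrMr //.
have H w : expect k (fun t => (nqueries (search s d X Y A (w :: t)) M)%:R) <=
    (price X Y w)%:R + 2 * k%:R :> R.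
  have [X1 [Y1 [A1 [[eA1 red1 [X10 Y10] _ _]]]]] :=
    search_cons w eA red (agree_subcover eA cov) X0 Y0.
  move=> E; under eq_expect do rewrite (E _).2 natrD.
  by rewrite expectD expect_cst ?sample_gt0 // lerD2l; apply: IH.
apply: le_trans (ler_sum _ (fun w _ => H w)) _.
apply: (@le_trans _ _ (2 * #|sample n m|%:R + 2 * k%:R * #|sample n m|%:R)).
  rewrite big_split /= sumr_const -natr_sum -[X in _ + X <= _]mulr_natr lerD2r.
  by rewrite -natrM ler_nat sum_price.
by rewrite -[k.+1%:R]natr1; lra.
Qed.

(** The potential [4 * B - #|X| * #|Y|] falls by at least [eps / 4] on average in a round started
    from a covered submatrix. It stays nonnegative: such a submatrix has area at most [B], and one
    round multiplies the area by at most 4, even if the cover is lost. *)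
Lemma expect_accept (eps : R) M k X Y A : 0 <= eps ->
  far eps (@sbr_le s d n m) M ->
  agree A M X Y -> reduced M X Y -> (0 < #|X|)%N -> (0 < #|Y|)%N ->
  (#|X| * #|Y| <= 4 * B)%N ->
  k%:R * (eps / 4) * expect k (fun t => (run (search s d X Y A t) M)%:R)
    <= (4 * B)%:R - (#|X| * #|Y|)%:R.
Proof.
move=> eps0 farM; elim: k X Y A => [|k IH] X Y A eA red X0 Y0 XYB.
  by rewrite !mul0r subr_ge0 ler_nat.
have [cov|ncov] := pselect (subcover s d A X Y); last first.
  under eq_expect do rewrite search_uncovered //.
  by rewrite expect_cst ?sample_gt0 // mulr0 subr_ge0 ler_nat.
have covM := agree_subcover eA cov.
have T0 : 0 < #|sample n m|%:R :> R by rewrite ltr0n sample_gt0.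
have XYB' := reduced_card covM red.
have H w : k%:R * (eps / 4) * expect k (fun t => (run (search s d X Y A (w :: t)) M)%:R) <=
    (4 * B)%:R - (#|X| * #|Y|)%:R - (gain M X Y w)%:R :> R.
  have [X1 [Y1 [A1 [[eA1 red1 [X10 Y10] g4 le4]]]]] := search_cons w eA red covM X0 Y0.
  move=> E; under eq_expect do rewrite (E _).1.
  rewrite -addrA -opprD -natrD -g4; apply: IH => //.
  by apply: leq_trans le4 _; rewrite leq_mul2l XYB'.
set E := expect _ _.
(* With [E <= 1], the average drop [eps / 4] pays for passing from the factor [k] to [k.+1]. *)
have E1 : E <= 1.
  rewrite -[leRHS](@expect_cst R (sample n m) k.+1) ?sample_gt0 //.
  by apply: expect_le => t; rewrite lern1 leq_b1.
have ET : #|sample n m|%:R * E =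
    \sum_w expect k (fun t => (run (search s d X Y A (w :: t)) M)%:R).
  by rewrite /E expectS mulrA mulfV ?mul1r // gt_eqF.
have [x0 x0X] : exists x, x \in X by apply/card_gt0P.
have [y0 y0Y] : exists y, y \in Y by apply/card_gt0P.
(* There are [4 * (n * m) ^ 2] samples, the 4 counting the choices of [ab], and at least
   [eps * n * m] successful attempts, each contributing at least [n * m]. *)
have gainE : #|sample n m|%:R * (eps / 4) <= (\sum_w gain M X Y w)%:R :> R.
  apply: le_trans (_ : _ <= ((\sum_ij \sum_ab fresh M X Y ab ij.1 ij.2) * (n * m))%:R) _.
    have -> : #|sample n m|%:R * (eps / 4) = eps * (n * m)%:R * (n * m)%:R.
      by rewrite card_sample natrM (natrM _ 4); lra.
    rewrite [leRHS]natrM ler_wpM2r // natr_sum.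
    under eq_bigr do rewrite natr_sum.
    exact: far_fresh red covM x0X y0Y farM.
  by rewrite ler_nat sum_gain.
have S : #|sample n m|%:R * (k%:R * (eps / 4) * E) <=
    #|sample n m|%:R * ((4 * B)%:R - (#|X| * #|Y|)%:R - eps / 4).
  rewrite mulrCA ET mulr_sumr; apply: le_trans (ler_sum _ (fun w _ => H w)) _.
  by rewrite sumrB sumr_const -natr_sum [leRHS]mulrBr -[X in X - _]mulr_natl lerB.
rewrite ler_pM2l // in S.
have hE : eps / 4 * E <= eps / 4 by rewrite ler_piMr // divr_ge0.
by rewrite -[k.+1%:R]natr1; lra.
Qed.

End Acceptance.

(** * The testers *)

Section Testers.
Variable R : realType.

Definition start (s d n m : nat) (i : 'I_n) (j : 'I_m) tape : dtree n m :=
  Query i j (fun b => search s d [set i] [set j] (fun _ _ => b) tape).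

(* With this many rounds, a far matrix survives with probability at most 1/6, and
   the budget is exceeded with probability at most 1/6. *)
Definition rounds (eps : R) (d s : nat) : nat :=
  (Num.trunc (96 * (binom_le d s * 2 ^ d)%:R / eps)).+1.

(** Its successor is [6 * (2 * L + 1)] for [L] rounds, six times the bound on the expected queries,
    counting the one made by [start]. *)
Definition budget (eps : R) (d s : nat) : nat := (12 * rounds eps d s + 5)%N.

Definition uniform_tester n m k (F : seq (sample n m) -> dtree n m) : rtester R n m :=
  [seq ((#|sample n m|%:R^-1) ^+ k, F t) | t <- tapes (sample n m) k].

Definition tester_le : tester_type R := fun eps d s n m =>
  if [pick i : 'I_n] is Some i then
    if [pick j : 'I_m] is Some j then
      uniform_tester (rounds eps d s) (fun t => trunc (budget eps d s) (start s d i j t))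
    else [:: (1, Leaf n m true)]
  else [:: (1, Leaf n m true)].

Lemma In_map (T U : Type) (f : T -> U) l p :
  Stdlib.Lists.List.In p (map f l) -> exists t, p = f t.
Proof. by elim: l => [//|a l IH] /= [<-|/IH //]; exists a. Qed.

Lemma accept_prob_uniform n m k F (M : bmat n m) :
  accept_prob (uniform_tester k F) M = expect k (fun t => (run (F t) M)%:R).
Proof. by rewrite /accept_prob big_map /expect mulr_sumr. Qed.

Lemma uniform_tester_distr n m k F : (0 < n * m)%N -> is_distr (@uniform_tester n m k F).
Proof.
move=> nm0; rewrite /uniform_tester; split=> [p H|]; first by have [t ->] := In_map H; rewrite exprn_ge0 // invr_ge0.
rewrite big_map -[RHS](@expect_cst R (sample n m) k) ?sample_gt0 //.
by rewrite /expect mulr_sumr; under [in RHS]eq_bigr do rewrite mulr1.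
Qed.

Lemma const_tester_distr n m b : is_distr [:: (1 : R, Leaf n m b)].
Proof. by split=> [p [<-|[]]|]; rewrite ?ler01 ?big_seq1. Qed.

Lemma dtree_accept n m (t : dtree n m) M : accept_prob [:: (1 : R, t)] M = (run t M)%:R.
Proof. by rewrite /accept_prob big_seq1 mul1r. Qed.

Section Bounds.
Variables (eps : R) (d s : nat).
Hypotheses (eps0 : 0 < eps) (eps1 : eps < 1).

Let B := (binom_le d s * 2 ^ d)%N.

Lemma binom_le_gt0 : (0 < binom_le d s)%N.
Proof. by rewrite /binom_le big_ord_recl bin0. Qed.

Lemma B_gt0 : (0 < B)%N.
Proof. by rewrite muln_gt0 binom_le_gt0 expn_gt0. Qed.

Lemma rounds_ge : 96 * B%:R <= (rounds eps d s)%:R * eps.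
Proof.
rewrite -ler_pdivrMr //; apply: ltW.
have /truncn_itv /andP[] // : 0 <= 96 * B%:R / eps by rewrite divr_ge0 ?mulr_ge0 // ltW.
Qed.

(** For [x = B / eps >= 1] one has [12 * (96 * x + 1) + 5 <= 1169 * x], so the constant leaves
    slack. *)
Lemma budget_le : (budget eps d s)%:R <= 1649 * B%:R / eps.
Proof.
have Be : 1 <= B%:R / eps.
  by rewrite ler_pdivlMr // mul1r (le_trans (ltW eps1)) // ler1n B_gt0.
have : (rounds eps d s)%:R <= 96 * B%:R / eps + 1.
  rewrite /rounds -[(Num.trunc _).+1%:R]natr1 lerD2r.
  by have /truncn_itv /andP[] : 0 <= 96 * B%:R / eps by rewrite divr_ge0 ?mulr_ge0 // ltW.
by rewrite natrD natrM -!mulrA; lra.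
Qed.

End Bounds.

Lemma tester_leP eps d s n m : 0 < eps < 1 ->
  let D := tester_le eps d s n m in
  [/\ is_distr D,
      query_bound D (1649 * (binom_le d s * 2 ^ d)%:R / eps),
      (forall M, sbr_le s d M -> accept_prob D M = 1) &
      (forall M, far eps (@sbr_le s d n m) M -> accept_prob D M <= 1/3)].
Proof.
move=> /andP[eps0 eps1]; rewrite /tester_le.
have trivial_case : (n * m = 0)%N -> let D := [:: (1 : R, Leaf n m true)] in
  [/\ is_distr D, query_bound D (1649 * (binom_le d s * 2 ^ d)%:R / eps),
      (forall M, sbr_le s d M -> accept_prob D M = 1) &
      (forall M, far eps (@sbr_le s d n m) M -> accept_prob D M <= 1/3)].
  move=> nm0; split.
  - exact: const_tester_distr.
  - by move=> p M [<-|[]] /=; rewrite divr_ge0 ?mulr_ge0 // ltW.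
  - by move=> M _; rewrite dtree_accept.
  - move=> M /(_ M); have noij (i : 'I_n) (j : 'I_m) : False.
      by case/eqP: nm0; rewrite muln_eq0 => /orP[] /eqP e;
        [case: i => i; rewrite e | case: j => j; rewrite e].
    rewrite /mdist eq_card0 => [|[i j]]; last by case: (noij i j).
    rewrite nm0 mulr0 ltxx => H; suff : false by []. apply: H.
    exists 0%N; split=> //; exists (fun _ => set0), (fun _ => set0).
    by split=> [k i j|i j]; case: (noij i j).
case: pickP => [i0 _|noi]; last first.
  by apply: trivial_case; case: n noi => // n' /(_ ord0).
case: pickP => [j0 _|noj]; last first.
  by apply: trivial_case; case: m noj => [|m' /(_ ord0)]; rewrite ?muln0.
have nm0 : (0 < n * m)%N by rewrite muln_gt0 (leq_ltn_trans _ (ltn_ord i0)) ?(leq_ltn_trans _ (ltn_ord j0)).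
set L := rounds _ _ _; set Q := budget _ _ _; set B := (_ * _)%N.
have agree0 (M : bmat n m) : agree (fun _ _ => M i0 j0) M [set i0] [set j0].
  by move=> i j /set1P -> /set1P ->.
have cardi : (0 < #|[set i0]|)%N by rewrite cards1.
have cardj : (0 < #|[set j0]|)%N by rewrite cards1.
split.
- exact: uniform_tester_distr.
- rewrite /uniform_tester => p M H; have [t ->] := In_map H; apply: le_trans (budget_le d s eps0 eps1).
  by rewrite ler_nat nqueries_trunc.
- move=> M /sbr_leE cM; rewrite accept_prob_uniform -[RHS](@expect_cst R (sample n m) L) ?sample_gt0 //.
  apply: eq_expect => t; rewrite run_trunc //=.
  exact: run_search_of_cover (agree0 M) (reduced_set11 _ _ _) cardi cardj cM.
move=> M farM; rewrite accept_prob_uniform.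
pose S t := search s d [set i0] [set j0] (fun _ _ => M i0 j0) t.
(* An accepting truncated run either accepts in full or would exceed [Q] queries; Markov's
   inequality bounds the latter. The added 1 is the query made by [start]. *)
apply: (@le_trans _ _ (expect L (fun t => (run (S t) M)%:R) +
    (Q.+1)%:R^-1 * (expect L (fun t => (nqueries (S t) M)%:R) + 1))).
  rewrite -[X in _ * (_ + X)](@expect_cst R (sample n m) L) ?sample_gt0 //.
  rewrite -expectD -expectZ -expectD; apply: expect_le => t.
  case: (boolP (run (trunc _ _) M)) => [/run_trunc_le|_]; last first.
    by apply: addr_ge0 => //; apply: mulr_ge0; [rewrite invr_ge0|apply: addr_ge0].
  rewrite /= -/(S t) natr1; case: (run (S t) M) => /= [_|lt].
    by rewrite lerDl mulr_ge0 ?invr_ge0.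
  by rewrite add0r mulrC ler_pdivlMr // mul1r ler_nat.
have acc := expect_accept nm0 L (ltW eps0) farM (agree0 M) (reduced_set11 _ _ _) cardi cardj.
have {}acc := acc _; rewrite !cards1 in acc.
have {}acc : L%:R * (eps / 4) * expect L (fun t => (run (S t) M)%:R) <= (4 * B)%:R - 1.
  apply: acc; rewrite muln_gt0; exact: B_gt0.
have qu := expect_queries R s d nm0 L (agree0 M) (reduced_set11 _ _ _) cardi cardj.
have LB : 96 * B%:R <= L%:R * eps := rounds_ge d s eps0.
have B0 : 1 <= B%:R :> R by rewrite ler1n; exact: B_gt0.
(* Here [L * eps / 4 >= 24 * B] meets the potential bound [4 * B]. *)
have a6 : expect L (fun t => (run (S t) M)%:R) <= 1 / 6 :> R.
  have p0 : 0 < L%:R * (eps / 4) by lra.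
  suff : L%:R * (eps / 4) * expect L (fun t => (run (S t) M)%:R) <= L%:R * (eps / 4) * (1 / 6).
    by rewrite ler_pM2l.
  by apply: le_trans acc _; rewrite natrM; lra.
have q6 : Q.+1%:R^-1 * (expect L (fun t => (nqueries (S t) M)%:R) + 1) <= 1 / 6 :> R.
  rewrite mulrC ler_pdivrMr ?ltr0n //.
  apply: le_trans (lerD qu (lexx 1)) _.
  by rewrite -[Q.+1%:R]natr1 natrD natrM; lra.
by apply: le_trans (lerD a6 q6) _; lra.
Qed.

End Testers.

(** * Reaching rank exactly d by few changes *)

Section ExactRank.
Variables (s n m : nat).
Implicit Types M : bmat n m.

(** Delete row [i0] from every rectangle and cover its ones by a single new rectangle of height
    one. *)
Lemma sbr_cover_row M M' r i0 : (0 < s)%N ->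
  (forall i j, i != i0 -> M' i j = M i j) ->
  sbr_cover s M r -> sbr_cover s M' r.+1.
Proof.
move=> s0 eM [I [J [IJ1 IJs]]].
pose I' k := if unlift ord0 k is Some k' then I k' :\ i0 else [set i0].
pose J' k := if unlift ord0 k is Some k' then J k' else [set j | M' i0 j].
exists I', J'; rewrite /I' /J'; split=> [k i j|i j Mij].
  case: unliftP => [k' _|_]; rewrite !inE.
    by move=> /andP[ii0 iI] jJ; rewrite eM //; apply: IJ1 jJ.
  by move=> /eqP ->.
have [ei|ne] := eqVneq i i0.
  rewrite (_ : [set k | _] = [set ord0]) ?cards1 //; apply/setP => k; rewrite !inE.
  case: unliftP => [k' ->|->]; rewrite !inE ei ?eqxx ?andbT //=.
  by rewrite -ei Mij.
rewrite (_ : [set k | _] = lift ord0 @: [set k | (i \in I k) && (j \in J k)]).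
  by rewrite card_imset; [apply: IJs; rewrite -eM | exact: lift_inj].
apply/setP => k; rewrite inE; case: unliftP => [k' ->|->].
  by rewrite mem_imset ?inE ?ne //; exact: lift_inj.
rewrite !inE (negbTE ne); apply/esym/imsetP => -[k' _ /eqP].
by rewrite (negbTE (neq_lift _ _)).
Qed.

Lemma sbr_cover_rows M : (0 < s)%N -> sbr_cover s M n.
Proof.
move=> s0; exists (fun k => [set k]), (fun k => [set j | M k j]); split=> [k i j|i j Mij].
  by rewrite !inE => /eqP ->.
rewrite (_ : [set k | _] = [set i]) ?cards1 //; apply/setP => k; rewrite !inE eq_sym.
by case: eqP => // ->.
Qed.

Lemma sbr_cover_cols M : (0 < s)%N -> sbr_cover s M m.
Proof.
move=> s0; exists (fun k => [set i | M i k]), (fun k => [set k]); split=> [k i j|i j Mij].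
  by rewrite !inE => ? /eqP ->.
rewrite (_ : [set k | _] = [set j]) ?cards1 //; apply/setP => k; rewrite !inE andbC eq_sym.
by case: eqP => // ->.
Qed.

(** A fooling set: a rectangle containing two diagonal ones of the identity block would contain an
    off-diagonal zero. *)
Lemma sbr_cover_identity_ge M d r : (d <= n)%N -> (d <= m)%N ->
  (forall (i : 'I_n) (j : 'I_m), (i < d)%N -> (j < d)%N -> M i j = (i == j :> nat)) ->
  sbr_cover s M r -> (d <= r)%N.
Proof.
move=> dn dm eM [I [J [IJ1 IJs]]].
pose a := widen_ord dn; pose b := widen_ord dm.
have Mab k : M (a k) (b k) by rewrite eM /= ?eqxx.
have ex k : exists l, (a k \in I l) && (b k \in J l).
  by have /andP[/card_gt0P[l]] := IJs _ _ (Mab k); rewrite inE; exists l.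
pose f k := xchoose (ex k).
have finj : injective f.
  move=> k k' e; have /andP[ak _] := xchooseP (ex k); have /andP[_ bk'] := xchooseP (ex k').
  rewrite -/(f k) -/(f k') e in ak bk'; have := IJ1 _ _ _ ak bk'.
  by rewrite eM //= => /eqP h; apply: val_inj.
by have := leq_card f finj; rewrite !card_ord.
Qed.

Lemma sbr_eq_nearby M d : (0 < s)%N -> (d <= n)%N -> (d <= m)%N ->
  sbr_le s d M -> exists2 M', sbr_eq s d M' & (mdist M M' <= d * d)%N.
Proof.
move=> s0 dn dm /sbr_leE cM.
case: d dn dm cM => [|d] dn dm cM.
  exists M; first by split.
  by rewrite /mdist eq_card0 // => ij; rewrite inE eqxx.
pose N t : bmat n m := fun i j =>
  if (i < minn t d.+1)%N && (j < d.+1)%N then i == j :> nat else M i j.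
have exN : `[< ~ sbr_cover s (N d.+1) d >].
  apply/asboolP => /sbr_cover_identity_ge => /(_ d.+1 dn dm).
  by rewrite ltnn => H; suff : false by []; apply: H => i j id jd; rewrite /N minnn id jd.
(* At the least [t] where [d] rectangles fail, [N t] has rank exactly [d.+1], the target after the
   case split: either [t = 0] and [N t] is [M], or [N t] differs in one row from its predecessor,
   which [d] rectangles cover. *)
have [t /asboolP nt tmin] := find_ex_minn (ex_intro (fun t => `[< ~ sbr_cover s (N t) d >]) _ exN).
exists (N t).
  split=> [|d' dd' cd']; last exact/nt/(sbr_cover_widen _ cd').
  case: t nt tmin => [_ _ //|t nt tmin].
  have tn : (t < n)%N by apply: leq_trans dn; apply: tmin.
  apply: (@sbr_cover_row (N t) _ _ (Ordinal tn)) => // [i j|].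
    rewrite -val_eqE /= => it; rewrite /N; congr (if _ && _ then _ else _).
    by rewrite !leq_min ltnS [RHS]andbC leq_eqVlt (negbTE it) andbC.
  apply: contrapT => nct; have := tmin t (asboolT nct); by rewrite ltnn.
pose wide (p : 'I_d.+1 * 'I_d.+1) := (widen_ord dn p.1, widen_ord dm p.2).
have <- : #|{: 'I_d.+1 * 'I_d.+1}| = (d.+1 * d.+1)%N by rewrite card_prod !card_ord.
apply: leq_trans (leq_imset_card wide _); apply/subset_leq_card/subsetP => -[i j].
rewrite inE /N /=; case: ifP => [/andP[it jd] _|]; last by rewrite eqxx.
have id : (i < d.+1)%N by apply: leq_trans it (geq_minr _ _).
by apply/imsetP; exists (Ordinal id, Ordinal jd) => //; congr pair; apply: val_inj.
Qed.

End ExactRank.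

(** * The tester for rank exactly d *)

Section ExactTester.
Variable R : realType.

Definition ask_all (n m : nat) (P : bmat n m -> Prop) : dtree n m :=
  ask (enum {: 'I_n * 'I_m}) (fun _ _ => false) (fun A => Leaf n m `[< P A >]).

Lemma run_ask_all n m P (M : bmat n m) : run (ask_all P) M = `[< P M >].
Proof.
have [A [eA -> _]] := askP (enum {: 'I_n * 'I_m}) (fun _ _ => false) (fun A => Leaf n m `[< P A >]) M.
suff -> : A = M by [].
by apply/funext => i; apply/funext => j; rewrite eA mem_enum.
Qed.

Lemma nqueries_ask_all n m P (M : bmat n m) : nqueries (ask_all P) M = (n * m)%N.
Proof.
have [A [_ _ ->]] := askP (enum {: 'I_n * 'I_m}) (fun _ _ => false) (fun A => Leaf n m `[< P A >]) M.
by rewrite addn0 -cardE card_prod !card_ord.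
Qed.

(** With fewer than [d] rows or columns rank [d] is impossible. The threshold on [eps * n * m]
    ensures that [d * d] changes cost at most half of the allowed distance. *)
Definition tester_eq : tester_type R := fun eps d s n m =>
  if (n < d)%N || (m < d)%N then [:: (1, Leaf n m false)]
  else if eps * (n * m)%:R < 2 * (d * d)%:R then [:: (1, ask_all (@sbr_eq s d n m))]
  else tester_le (eps / 2) d s n m.

Lemma mdist_triangle n m (M M' M'' : bmat n m) :
  (mdist M M'' <= mdist M M' + mdist M' M'')%N.
Proof.
rewrite /mdist; apply: leq_trans (leq_card_setU _ _); apply/subset_leq_card/subsetP => p.
by rewrite !inE; have [->|] := eqVneq (M p.1 p.2) (M' p.1 p.2).
Qed.

Lemma far_sbr_le (eps : R) s d n m (M : bmat n m) : (0 < s)%N -> (d <= n)%N -> (d <= m)%N ->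
  2 * (d * d)%:R <= eps * (n * m)%:R ->
  far eps (@sbr_eq s d n m) M -> far (eps / 2) (@sbr_le s d n m) M.
Proof.
move=> s0 dn dm dd farM M' /(sbr_eq_nearby s0 dn dm)[M'' /farM far'' near].
have : (mdist M M'')%:R <= (mdist M M')%:R + (d * d)%:R :> R.
  by rewrite -natrD ler_nat (leq_trans (mdist_triangle M M' M'')) // leq_add2l.
lra.
Qed.

Lemma tester_eqP eps d s n m : 0 < eps < 1 -> (1 <= s)%N -> (1 <= d)%N ->
  let D := tester_eq eps d s n m in
  [/\ is_distr D,
      query_bound D (3298 * (d * binom_le d s * 2 ^ d)%:R / eps),
      (forall M, sbr_eq s d M -> accept_prob D M = 1) &
      (forall M, far eps (@sbr_eq s d n m) M -> accept_prob D M <= 1/3)].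
Proof.
move=> /andP[eps0 eps1] s0 d0; rewrite /tester_eq.
have [small|] := boolP ((n < d)%N || (m < d)%N).
  have noM (M : bmat n m) : ~ sbr_eq s d M.
    by move=> [_ H]; case/orP: small => /H; apply; [apply: sbr_cover_rows | apply: sbr_cover_cols].
  split.
  - exact: const_tester_distr.
  - by move=> p M [<-|[]] /=; rewrite divr_ge0 ?mulr_ge0 // ltW.
  - by move=> M /noM.
  - by move=> M _; rewrite dtree_accept divr_ge0.
rewrite negb_or -!leqNgt => /andP[dn dm].
(* As [d <= 2 ^ d], reading fewer than [2 * d ^ 2 / eps] entries fits the bound. *)
have dB : (d * d <= d * binom_le d s * 2 ^ d)%N.
  rewrite -mulnA leq_mul2l; apply/orP; right.
  by apply: leq_trans (ltnW (ltn_expl d (isT : 1 < 2)%N)) _; rewrite leq_pmull ?binom_le_gt0.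
have [few|many] := ltrP.
  split.
  - by split=> [p [<-|[]]|]; rewrite ?ler01 ?big_seq1.
  - move=> p M [<-|[]] /=; rewrite nqueries_ask_all ler_pdivlMr // mulrC.
    have B0 := ler0n R (d * binom_le d s * 2 ^ d); rewrite -(ler_nat R) in dB; lra.
  - by move=> M eM; rewrite dtree_accept run_ask_all asboolT.
  - move=> M farM; rewrite dtree_accept run_ask_all asboolF ?divr_ge0 // => eM.
    have := farM _ eM; rewrite /mdist eq_card0 => [|p]; last by rewrite inE eqxx.
    by rewrite ltNge mulr_ge0 // ltW.
have eps2 : 0 < eps / 2 < 1 by lra.
have [distr qb acc rej] := tester_leP d s n m eps2; split=> //.
- move=> p M pD; apply: le_trans (qb p M pD) _.
  rewrite invf_div mulrA ler_pM2r ?invr_gt0 // mulrC mulrA -natrM.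
  have : (binom_le d s * 2 ^ d <= d * binom_le d s * 2 ^ d)%N by rewrite -mulnA leq_pmull.
  by rewrite -(ler_nat R) !natrM; lra.
- by move=> M [cM _]; apply/acc/sbr_leE.
- by move=> M /(far_sbr_le s0 dn dm many); apply: rej.
Qed.

End ExactTester.

Theorem theorem1 (R : realType) :
  exists C : R, 0 < C /\
    let q := fun (eps : R) (d s : nat) =>
               C * (d * binom_le d s * 2 ^ d)%:R / eps in
    (exists T : tester_type R, one_sided_tester T sbr_le q) /\
    (exists T : tester_type R, one_sided_tester T sbr_eq q).
Proof.
(* [3298 = 2 * 1649]: the factor 2 comes from running [tester_le] at [eps / 2] for rank exactly
   [d]. *)
exists 3298; split; first by rewrite ltr0n.
move=> q; split; last by exists (@tester_eq R) => eps d s n m; apply: tester_eqP.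
exists (@tester_le R) => eps d s n m eps01 _ d0.
have [distr qb acc rej] := tester_leP d s n m eps01; split=> // p M pD; apply: le_trans (qb p M pD) _.
have /andP[eps0 _] := eps01.
rewrite /q ler_pM2r ?invr_gt0 //.
have : (binom_le d s * 2 ^ d <= d * binom_le d s * 2 ^ d)%N by rewrite -mulnA leq_pmull.
by have := ler0n R (d * binom_le d s * 2 ^ d); rewrite -(ler_nat R); lra.
Qed.
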